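(* Let $\mathbf{A}$ be a finite algebra, and suppose that $\mathrm{Con}(\mathbf{A})$ contains a pentagon $[\gamma,\delta,\theta]$ whose critical quotient is a covering $\delta\prec\theta$ with $\mathrm{typ}(\delta,\theta)=\mathbf{i}$. If $\mathbf{i}\neq\mathbf{1}$ and $U$ is a $\langle\delta,\theta\rangle$-minimal set, then $U$ has nonempty tail.
   Context: This uses tame congruence theory (Hobby–McKenzie). For a finite algebra $\mathbf{A}$ and a covering pair $\delta\prec\theta$ in $\mathrm{Con}(\mathbf{A})$, a $\langle\delta,\theta\rangle$-minimal set is a set $U\subseteq A$ minimal under inclusion among all sets of the form $e(A)$, with $e$ an idempotent unary polynomial of $\mathbf{A}$, such that $\delta|_U\neq\theta|_U$. A trace of $U$ is a $\theta|_U$-class that is not a $\delta|_U$-class; the body $B$ of $U$ is the union of the traces, and the tail is $T=U\setminus B$. $\mathrm{typ}(\delta,\theta)\in\{\mathbf{1},\mathbf{2},\mathbf{3},\mathbf{4},\mathbf{5}\}$ is the tame congruence theory type of the covering. A pentagon $[\gamma,\delta,\theta]$ in a lattice is the five-element sublattice generated by $\gamma,\delta,\theta$ where $\delta<\theta$, $\gamma\vee\delta\ge\theta$ and $\gamma\wedge\theta\le\delta$; its critical quotient is $\langle\delta,\theta\rangle$. A pentagon of type $\mathbf{i}$ is one whose critical quotient is a covering of type $\mathbf{i}$. *)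

(* Defs.v *)
From mathcomp Require Import all_boot.
Set Implicit Arguments. Unset Strict Implicit. Unset Printing Implicit Defensive.

Section TCT.
Variables (A : finType) (I : Type) (ar : I -> nat)
          (op : forall i : I, ('I_(ar i) -> A) -> A).

Inductive poly (n : nat) : (('I_n -> A) -> A) -> Prop :=
| poly_proj (k : 'I_n) : poly (fun x => x k)
| poly_const (c : A) : poly (fun _ => c)
| poly_app (i : I) (g : 'I_(ar i) -> ('I_n -> A) -> A) :
    (forall j, poly (g j)) -> poly (fun x => op (fun j => g j x)).

Definition unary_poly (f : A -> A) : Prop :=
  poly (n := 1) (fun x => f (x ord0)).

Definition is_con (r : A -> A -> Prop) : Prop :=
  (forall x, r x x) /\ (forall x y, r x y -> r y x) /\
  (forall x y z, r x y -> r y z -> r x z) /\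
  (forall i (x y : 'I_(ar i) -> A), (forall j, r (x j) (y j)) ->
       r (op x) (op y)).

Definition con_le (r s : A -> A -> Prop) : Prop := forall x y, r x y -> s x y.
Definition con_lt (r s : A -> A -> Prop) : Prop := con_le r s /\ ~ con_le s r.

Definition covers (d t : A -> A -> Prop) : Prop :=
  is_con d /\ is_con t /\ con_lt d t /\
  ~ (exists m, is_con m /\ con_lt d m /\ con_lt m t).

Definition le_join (t g d : A -> A -> Prop) : Prop :=
  forall m, is_con m -> con_le g m -> con_le d m -> con_le t m.

Definition pentagon (g d t : A -> A -> Prop) : Prop :=
  is_con g /\ is_con d /\ is_con t /\ con_lt d t /\ le_join t g d /\
  (forall x y, g x y -> t x y -> d x y).

Definition idem_poly_image (U : {set A}) : Prop :=
  exists e : A -> A, unary_poly e /\ (forall x, e (e x) = e x) /\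
    U = e @: [set: A].

(* delta|_U <> theta|_U  (given delta <= theta) *)
Definition separates (d t : A -> A -> Prop) (U : {set A}) : Prop :=
  exists x y, x \in U /\ y \in U /\ t x y /\ ~ d x y.

Definition minimal_set (d t : A -> A -> Prop) (U : {set A}) : Prop :=
  idem_poly_image U /\ separates d t U /\
  forall V : {set A}, idem_poly_image V -> separates d t V ->
    V \subset U -> V = U.

Definition trace (d t : A -> A -> Prop) (U N : {set A}) : Prop :=
  (exists x, x \in U /\ forall y, y \in N <-> (y \in U /\ t x y)) /\
  (exists y z, y \in N /\ z \in N /\ ~ d y z).

Definition in_body (d t : A -> A -> Prop) (U : {set A}) (u : A) : Prop :=
  exists N, trace d t U N /\ u \in N.

Definition nonempty_tail (d t : A -> A -> Prop) (U : {set A}) : Prop :=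
  exists u, u \in U /\ ~ in_body d t U u.

(* Type of the covering d < t.  By definition (Hobby-McKenzie),
   typ(d,t) = typ of the minimal algebra (A/d)|_{N/d}, N a trace of a
   <d,t>-minimal set.  Its polynomial operations are induced by the
   polynomials p of A with p(N^n) contained (mod d) in N.
   typ = 1 iff this minimal algebra is polynomially equivalent to a G-set,
   i.e. iff all its polynomial operations are essentially (at most) unary. *)
Definition ess_unary_mod (d : A -> A -> Prop) (N : {set A}) (n : nat)
    (p : ('I_n -> A) -> A) : Prop :=
  exists S : {set 'I_n}, #|S| <= 1 /\
    forall x y : 'I_n -> A, (forall k, x k \in N) -> (forall k, y k \in N) ->
      (forall k, k \in S -> d (x k) (y k)) -> d (p x) (p y).

Definition typ_is_1 (d t : A -> A -> Prop) : Prop :=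
  forall U N, minimal_set d t U -> trace d t U N ->
  forall n (p : ('I_n -> A) -> A), poly p ->
    (forall x : 'I_n -> A, (forall k, x k \in N) ->
        exists y, y \in N /\ d (p x) y) ->
    ess_unary_mod d N p.

End TCT.

(* Main.v *)
(* Suppose that every element of U lies in the body. A unary polynomial mapping U into itself is either a permutation of U or collapses theta into delta on U. If some binary polynomial f has theta-related c, c' in U with f(c, -) a permutation and f(c', -) collapsing, then U has only one trace, so U is a single theta-class; then gamma restricted to U lies below delta, and so does its join with delta, contradicting delta < theta on U. Otherwise a polynomial depending on two variables on a trace acts as a quasigroup operation on it, so every b in U is a neutral element of some binary polynomial on U. As in the Maltsev argument, gamma and delta then permute on U, and the modular law delta = theta /\ (gamma \/ delta) holds on U, again a contradiction. *)
Require Import Defs.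
From mathcomp Require Import all_boot.
From Stdlib Require Import Classical FunctionalExtensionality.
Set Implicit Arguments. Unset Strict Implicit. Unset Printing Implicit Defensive.

(** * Coordinate changes in tuples, and iterates of permutations *)

Definition upd (A : Type) n (x : 'I_n -> A) (k : 'I_n) (a : A) : 'I_n -> A :=
  fun j => if j == k then a else x j.

Lemma upd_same (A : Type) n (x : 'I_n -> A) k : upd x k (x k) = x.
Proof. by apply: functional_extensionality => j; rewrite /upd; case: eqP => [->|]. Qed.

Lemma updC (A : Type) n (x : 'I_n -> A) i j a b :
  i != j -> upd (upd x i a) j b = upd (upd x j b) i a.
Proof.
move=> neq; apply: functional_extensionality => k; rewrite /upd.
by case: eqP => // ->; rewrite eq_sym (negbTE neq).
Qed.

(** Walks from [x] to [y] by changing one coordinate at a time, which reduces claims about several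
    variables to unary polynomials. *)
Lemma upd_ind (A : Type) n (P : ('I_n -> A) -> Prop) (x y : 'I_n -> A) :
  (forall z k, P z -> P (upd z k (y k))) -> P x -> P y.
Proof.
move=> step Px.
have all_upd (s : seq 'I_n) :
    exists z, P z /\ forall k, k \in s -> z k = y k.
  elim: s => [|k s [z [Pz zs]]]; first by exists x.
  exists (upd z k (y k)); split; first exact: step.
  move=> j; rewrite inE /upd; case: eqP => [-> //|_ /=]; exact: zs.
have [z [Pz zy]] := all_upd (enum 'I_n).
suff -> : y = z by [].
by apply: functional_extensionality => k; rewrite zy ?mem_enum.
Qed.

(** Cycle lengths are at most [#|A|], so they divide its factorial. One exponent serves all
    permutations, so a binary polynomial can be iterated uniformly in its parameter. *)
Lemma iter_fact_card (A : finType) (U : {set A}) (f : A -> A) :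
  {in U, forall x, f x \in U} -> {in U &, injective f} ->
  {in U, forall x, iter #|A|`! f x = x}.
Proof.
move=> fU fI x xU.
have ord_dvd : order f x %| #|A|`!.
  by rewrite dvdn_fact // order_gt0 max_card.
have /dvdnP[m ->] := ord_dvd.
elim: m => [//|m IH].
by rewrite mulSn iterD IH (iter_order_in fU fI xU).
Qed.

Lemma iter_in (A : finType) (U : {set A}) (f : A -> A) n :
  {in U, forall x, f x \in U} -> {in U, forall x, iter n f x \in U}.
Proof. by move=> fU x xU; elim: n => //= n; apply: fU. Qed.

(** * Polynomials and congruences *)

Section Algebra.
Variables (A : finType) (I : Type) (ar : I -> nat)
          (op : forall i : I, ('I_(ar i) -> A) -> A).

Local Notation up := (unary_poly op).
Local Notation con := (is_con op).

Definition binary_poly (f : A -> A -> A) : Prop :=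
  poly op (n := 2) (fun x => f (x ord0) (x ord_max)).

Lemma poly_comp n m (p : ('I_n -> A) -> A) (g : 'I_n -> ('I_m -> A) -> A) :
  poly op p -> (forall k, poly op (g k)) -> poly op (fun x => p (fun k => g k x)).
Proof.
move=> pp pg; elim: pp => [k|c|i h _ IH]; [exact: pg|exact: poly_const|].
exact: (poly_app (g := fun j x => h j (fun k => g k x))).
Qed.

Lemma up_poly n f (g : ('I_n -> A) -> A) :
  up f -> poly op g -> poly op (fun x => f (g x)).
Proof. by move=> uf pg; exact: (poly_comp (g := fun _ => g) uf). Qed.

Lemma bp_poly n f (g h : ('I_n -> A) -> A) :
  binary_poly f -> poly op g -> poly op h -> poly op (fun x => f (g x) (h x)).
Proof.
move=> bf pg ph.
by apply: (poly_comp (g := fun k : 'I_2 => if k == ord0 then g else h) bf) => k; case: ifP.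
Qed.

Lemma up_id : up id.
Proof. exact: poly_proj. Qed.

Lemma up_comp f g : up f -> up g -> up (f \o g).
Proof. exact: up_poly. Qed.

Lemma up_iter n f : up f -> up (iter n f).
Proof. by move=> uf; elim: n => [|n IH]; [exact: up_id | exact: (up_poly uf IH)]. Qed.

Lemma bp_left f a : binary_poly f -> up (f a).
Proof. by move=> bf; apply: (bp_poly bf); [exact: poly_const | exact: poly_proj]. Qed.

Lemma bp_right f a : binary_poly f -> up (f^~ a).
Proof. by move=> bf; apply: (bp_poly bf); [exact: poly_proj | exact: poly_const]. Qed.

Lemma bp_iter n f : binary_poly f -> binary_poly (fun x => iter n (f x)).
Proof.
move=> bf; elim: n => [|n IH]; first exact: poly_proj.
exact: (bp_poly bf (poly_proj op ord0) IH).
Qed.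

Lemma up_upd n (p : ('I_n -> A) -> A) x i : poly op p -> up (fun a => p (upd x i a)).
Proof.
move=> pp; apply: (poly_comp (g := fun k z => upd x i (z ord0) k) pp) => k.
by rewrite /upd; case: (k == i); [exact: poly_proj | exact: poly_const].
Qed.

Lemma bp_upd n (p : ('I_n -> A) -> A) x i j :
  poly op p -> binary_poly (fun a b => p (upd (upd x i a) j b)).
Proof.
move=> pp.
apply: (poly_comp (g := fun k z => upd (upd x i (z ord0)) j (z ord_max) k) pp) => k.
rewrite /upd; case: (k == j); first exact: poly_proj.
by case: (k == i); [exact: poly_proj | exact: poly_const].
Qed.

Section Congruence.
Variables (r : A -> A -> Prop) (rC : con r).

Lemma con_refl x : r x x. Proof. by case: rC. Qed.
Lemma con_sym x y : r x y -> r y x. Proof. by case: rC => _ []; auto. Qed.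
Lemma con_trans y x z : r x y -> r y z -> r x z.
Proof. by case: rC => _ [_ [tr _]]; apply: tr. Qed.

Lemma con_poly n (p : ('I_n -> A) -> A) x y :
  poly op p -> (forall k, r (x k) (y k)) -> r (p x) (p y).
Proof.
move=> pp xy; elim: pp => [//|c|i g _ IH]; first exact: con_refl.
by case: rC => _ [_ [_]]; apply.
Qed.

Lemma con_up f x y : up f -> r x y -> r (f x) (f y).
Proof. by move=> uf xy; apply: (con_poly (x := fun=> x) (y := fun=> y) uf). Qed.

End Congruence.

(** For an equivalence relation [R], the largest congruence contained in [R]. *)
Definition poly_core (R : A -> A -> Prop) (x y : A) : Prop :=
  forall f, up f -> R (f x) (f y).

(** For compatibility, arguments of [op] are replaced one at a time: with the others frozen, [f]
    after [op] is a unary polynomial. *)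
Lemma poly_core_con (R : A -> A -> Prop) :
  (forall x, R x x) -> (forall x y, R x y -> R y x) ->
  (forall x y z, R x y -> R y z -> R x z) -> con (poly_core R).
Proof.
move=> Rr Rs Rt; split; first by move=> x f _; apply: Rr.
split; first by move=> x y xy f uf; apply/Rs/xy.
split; first by move=> x y z xy yz f uf; apply: Rt (xy f uf) (yz f uf).
move=> i x y xy f uf.
pose P z := (forall k, poly_core R (z k) (y k)) /\ R (f (op x)) (f (op z)).
suff [] : P y by [].
apply: (upd_ind (P := P) (x := x)) => [z k [zy xz]|]; last by split.
split=> [j|]; first by rewrite /upd; case: eqP => [-> g _|_]; [exact: Rr | exact: zy].
apply: (Rt _ _ _ xz); rewrite -{1}(upd_same z k).
have ug : up (fun a => f (op (upd z k a))).
  apply: (up_poly uf (up_upd z k _)).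
  by apply: (poly_app (g := fun j w => w j)) => j; exact: poly_proj.
exact: zy ug.
Qed.

(** If at most one coordinate influences [p] modulo [r], the set of influential coordinates
    witnesses essential unarity: changing the others one by one stays in one [r]-class. *)
Lemma ess_unary_or_two_dependencies (r : A -> A -> Prop) (N : {set A}) n (p : ('I_n -> A) -> A) :
  con r -> poly op p -> ~ ess_unary_mod r N p ->
  let dep (i : 'I_n) := exists (x : 'I_n -> A) a, (forall k, x k \in N) /\ a \in N /\ ~ r (p x) (p (upd x i a)) in
  exists i j : 'I_n, i != j /\ dep i /\ dep j.
Proof.
move=> rC pp nunary dep; apply: NNPP => no_pair; apply: nunary.
have unary_on (S : {set 'I_n}) : (forall k, dep k -> k \in S) -> #|S| <= 1 ->
    ess_unary_mod r N p.
  move=> depS S1; exists S; split=> // x y xN yN xy.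
  pose P z := (forall k, z k \in N) /\ (forall k, k \in S -> r (z k) (y k)) /\ r (p x) (p z).
  suff [_ []] : P y by [].
  apply: (upd_ind (P := P) (x := x)) => [z k [zN [zy xz]]|];
    last by split=> //; split=> //; exact: con_refl.
  split=> [j|]; first by rewrite /upd; case: eqP.
  split=> [j jS|].
    by rewrite /upd; case: eqP => [->|_]; [exact: con_refl | exact: zy].
  apply: (con_trans rC xz); case: (boolP (k \in S)) => [kS|kS].
    apply: (con_poly rC pp) => j; rewrite /upd.
    by case: eqP => [->|_]; [exact: zy | exact: con_refl].
  apply: NNPP => nr; case/negP: kS; apply: depS.
  by exists z, (y k).
case: (classic (exists i, dep i)) => [[i di]|nd]; last first.
  by apply: (unary_on set0); [move=> k dk; case: nd; exists k | rewrite cards0].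
apply: (unary_on [set i]); last by rewrite cards1.
move=> k dk; rewrite inE; apply/eqP; apply: NNPP => ki.
by apply: no_pair; exists k, i; split; [exact/eqP|].
Qed.

(* Restriction to e(A) preserves joins: it suffices that R is an equivalence relation containing the restrictions of g and d to e(A), since [poly_core] turns it into a congruence of the whole algebra. *)
Lemma le_join_retract (g d t R : A -> A -> Prop) (e : A -> A) :
  le_join op t g d -> up e -> con g -> con d ->
  (forall x, R x x) -> (forall x y, R x y -> R y x) ->
  (forall x y z, R x y -> R y z -> R x z) ->
  (forall x y, g (e x) (e y) -> R (e x) (e y)) ->
  (forall x y, d (e x) (e y) -> R (e x) (e y)) ->
  forall x y, t x y -> R (e x) (e y).
Proof.
move=> tj ue gC dC Rr Rs Rt gR dR x y txy.
have coreC := poly_core_con (R := fun x y => R (e x) (e y))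
  (fun x => Rr (e x)) (fun x y => @Rs (e x) (e y)) (fun x y z => @Rt (e x) (e y) (e z)).
apply: (tj _ coreC _ _ _ _ txy id up_id) => u v uv f uf.
  by apply: gR; do 2! apply: (con_up gC) => //.
by apply: dR; do 2! apply: (con_up dC) => //.
Qed.

(** * Separation by polynomials across a covering *)

Section Cover.
Variables (d t : A -> A -> Prop) (cov : covers op d t).

Let dC : con d. Proof. by case: cov. Qed.
Let tC : con t. Proof. by case: cov => _ []. Qed.
Let d_le_t x y : d x y -> t x y. Proof. by case: cov => _ [_ [[dt _] _]]; exact: dt. Qed.

(** Otherwise the meet of [t] with [poly_core R] lies strictly between [d] and [t]: it contains the
    pair [x], [y] but not [x0], [y0]. *)
Lemma separating_poly (R : A -> A -> Prop) x0 y0 x y :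
  (forall x, R x x) -> (forall x y, R x y -> R y x) ->
  (forall x y z, R x y -> R y z -> R x z) ->
  (forall x y, d x y -> R x y) ->
  t x0 y0 -> ~ R x0 y0 -> t x y -> ~ d x y ->
  exists f, up f /\ ~ R (f x) (f y).
Proof.
move=> Rr Rs Rt dR t0 nR0 txy ndxy; apply: NNPP => nof.
have coreC := poly_core_con Rr Rs Rt.
have [_ [_ [_ nomid]]] := cov; apply: nomid.
exists (fun u v => t u v /\ poly_core R u v); split; [|split].
- have [cr [cs [ct co]]] := coreC; have [tr [ts [tt to]]] := tC.
  split; first by split.
  split; first by move=> u v []; split; auto.
  split; first by move=> u v w [? ?] [? ?]; split; [apply: tt | apply: ct]; eassumption.
  by move=> i u v uv; split; [apply: to|apply: co] => j; case: (uv j).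
- split=> [u v uv|le]; first by split=> [|f uf]; [exact: d_le_t | exact/dR/(con_up dC)].
  apply: ndxy; apply: le; split=> // f uf.
  by apply: NNPP => nR; apply: nof; exists f.
- split=> [u v []//|le].
  by apply: nR0; case: (le _ _ t0) => _ /(_ id up_id).
Qed.

Definition noncollapsing (f : A -> A) : Prop :=
  exists x y, t x y /\ ~ d (f x) (f y).

(** Induction on the size of the image of [f]. Some [g] keeps [f \o g \o f] noncollapsing; either
    its image is smaller, or [f \o g] permutes the image of [f] and a power of it is idempotent with
    that image. *)
Lemma noncollapsing_idempotent f : up f -> noncollapsing f ->
  exists V : {set A}, idem_poly_image op V /\ separates d t V /\ V \subset f @: [set: A].
Proof.
have [n] := ubnP #|f @: [set: A]|; elim: n f => // n IH f ltn uf ncf.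
have [x [y [txy nd]]] := ncf.
have [g [ug ndg]] : exists g, up g /\ ~ d (f (g (f x))) (f (g (f y))).
  apply: (separating_poly (R := fun u v => d (f u) (f v)) (x0 := x) (y0 := y)) => //.
  - by move=> u; exact: con_refl.
  - by move=> u v; exact: con_sym.
  - by move=> u v w uv vw; exact: (con_trans dC uv vw).
  - by move=> u v; exact: (con_up dC uf).
  - exact: (con_up tC uf).
have uh : up (f \o g) by exact: up_comp.
have sub : (f \o g \o f) @: [set: A] \subset f @: [set: A].
  by apply/subsetP=> _ /imsetP[z _ ->]; exact: imset_f.
case: (ltnP #|(f \o g \o f) @: [set: A]| #|f @: [set: A]|) => [lt|le].
  have [|V [iV [sV VS]]] := IH _ (leq_trans lt ltn) (up_comp uh uf).
    by exists x, y.
  by exists V; split=> //; split=> //; exact: subset_trans VS sub.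
set V := f @: [set: A] in sub le ltn.
have fgV : {in V, forall x, (f \o g) x \in V} by move=> z _; exact: imset_f.
have fgI : {in V &, injective (f \o g)}.
  by apply/imset_injP; rewrite eqn_leq leq_imset_card /= /V -imset_comp.
set r := #|A|`!.
have rid : {in V, forall x, iter r (f \o g) x = x} by exact: iter_fact_card.
have rV z : iter r (f \o g) z \in V.
  by rewrite /r; case: (_`!) (fact_gt0 #|A|) => // m _; rewrite iterS; apply: imset_f.
exists V; split.
  exists (iter r (f \o g)); split; first exact: up_iter.
  split=> [z|]; first exact: rid.
  apply/setP=> z; apply/idP/imsetP => [zV|[w _ ->] //].
  by exists z; rewrite ?inE ?rid.
split=> //; exists (f x), (f y); rewrite !imset_f ?inE //; split=> //; split=> //.
by split=> //; exact: (con_up tC uf).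
Qed.

(** * Unary polynomials on a minimal set: permute or collapse *)

Section MinimalSet.
Variables (U : {set A}) (Umin : minimal_set op d t U).

Lemma minimal_retraction :
  exists e, up e /\ (forall x, e x \in U) /\ {in U, forall x, e x = x}.
Proof.
have [[e [ue [ee ->]]] _] := Umin; exists e; split=> //; split=> [x|]; first exact: imset_f.
by move=> _ /imsetP[x _ ->]; exact: ee.
Qed.

Lemma noncollapsing_onto f :
  up f -> (forall x, f x \in U) -> noncollapsing f -> f @: [set: A] = U.
Proof.
move=> uf fU ncf; have [V [iV [sV VS]]] := noncollapsing_idempotent uf ncf.
have fS : f @: [set: A] \subset U by apply/subsetP=> _ /imsetP[z _ ->].
have [_ [_ Um]] := Umin.
by apply/eqP; rewrite eqEsubset fS -{1}(Um V iV sV (subset_trans VS fS)).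
Qed.

(** After composing [f] with the retraction onto [U], minimality makes the image all of [U]; a
    surjection of a finite set onto itself is injective. *)
Lemma noncollapsing_inj f x y : up f -> {in U, forall x, f x \in U} ->
  x \in U -> y \in U -> t x y -> ~ d (f x) (f y) -> {in U &, injective f}.
Proof.
move=> uf fU xU yU txy nd; have [e [ue [eU eid]]] := minimal_retraction.
have onto : (f \o e) @: [set: A] = U.
  apply: noncollapsing_onto => [|z|]; [exact: up_comp | exact/fU/eU|].
  by exists x, y; rewrite /= !eid.
apply/imset_injP; rewrite eqn_leq leq_imset_card /=.
apply: subset_leq_card; rewrite -{1}onto; apply/subsetP=> _ /imsetP[z _ ->].
exact/imset_f/eU.
Qed.

(** The inverse of [f] on [U] is a power of [f], hence a polynomial preserving [r]. *)
Lemma inj_reflects r f x y : con r -> up f -> {in U, forall x, f x \in U} ->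
  {in U &, injective f} -> x \in U -> y \in U -> r (f x) (f y) -> r x y.
Proof.
move=> rC uf fU fI xU yU rxy.
rewrite -(iter_fact_card fU fI xU) -(iter_fact_card fU fI yU).
case: (_`!) (fact_gt0 #|A|) => // m _; rewrite !iterSr.
exact: (con_up rC (up_iter m uf)).
Qed.

Lemma inj_noncollapsing f : up f -> {in U, forall x, f x \in U} ->
  {in U &, injective f} -> exists x y, x \in U /\ y \in U /\ t x y /\ ~ d (f x) (f y).
Proof.
move=> uf fU fI; have [_ [[x [y [xU [yU [txy nd]]]]] _]] := Umin.
exists x, y; do 3!split=> //; move=> /(inj_reflects dC uf fU fI xU yU); exact: nd.
Qed.

(* Hobby-McKenzie's twin lemma: [f c] and [f c'] can only behave differently when U has a single trace. *)
Lemma twin_single_trace f c c' a a' :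
  binary_poly f -> (forall x y, x \in U -> y \in U -> f x y \in U) ->
  c \in U -> c' \in U -> t c c' ->
  {in U &, injective (f c)} -> ~ {in U &, injective (f c')} ->
  a \in U -> a' \in U -> t a a' -> ~ d a a' -> t c a.
Proof.
move=> bf fU cU c'U tcc' fcI fc'nI aU a'U taa' ndaa'.
(* Iteration turns each permutation [f x] of [U] into the identity on [U], and leaves the other
   [f x] collapsing. *)
pose h x := iter #|A|`! (f x).
have bh : binary_poly h by exact: bp_iter.
have uhl x : up (h x) by exact: bp_left.
have uhr x : up (h^~ x) by exact: bp_right.
have hU x y : x \in U -> y \in U -> h x y \in U.
  by move=> xU; apply: iter_in => z; exact: fU.
have hid x y : x \in U -> y \in U -> {in U &, injective (f x)} -> h x y = y.
  by move=> xU yU fI; apply: iter_fact_card yU => // z zU; exact: fU.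
have hcol x y z : x \in U -> ~ {in U &, injective (f x)} ->
    y \in U -> z \in U -> t y z -> d (h x y) (h x z).
  move=> xU nI yU zU tyz; apply: NNPP => nd; apply: nI.
  have hI : {in U &, injective (h x)}.
    by apply: (noncollapsing_inj _ _ yU zU tyz nd) => // w; exact: hU.
  move=> v w vU wU vw; apply: hI => //.
  rewrite /h; case: (_`!) (fact_gt0 #|A|) => // m _.
  by rewrite !iterSr vw.
have ndcc' : ~ d c c'.
  move=> dcc'; apply: fc'nI.
  have fcU : {in U, forall x, f c x \in U} by move=> z; exact: fU.
  have [x [y [xU [yU [txy nd]]]]] := inj_noncollapsing (bp_left c bf) fcU fcI.
  apply: (noncollapsing_inj (bp_left c' bf) _ xU yU txy) => [z|]; first exact: fU.
  move=> dc'; apply: nd; apply: (con_trans dC (con_up dC (bp_right x bf) dcc')).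
  apply: (con_trans dC dc'); apply: (con_up dC (bp_right y bf)); exact: con_sym.
(* One of [c], [c'] serves: [h c'] sends both into one [d]-class, which cannot contain both. *)
have [one [oneU [tcone ndone]]] : exists one, one \in U /\ t c one /\ ~ d one (h c' one).
  case: (classic (d c (h c' c))) => dc; last by exists c; split=> //; split=> //; exact: con_refl.
  exists c'; split=> //; split=> // dc'; apply: ndcc'.
  apply: (con_trans dC dc); apply: (con_trans dC (hcol _ _ _ c'U fc'nI cU c'U tcc')).
  exact: con_sym.
pose u x := h x one.
have uU : {in U, forall x, u x \in U} by move=> x xU; exact: hU.
have uc : u c = one by exact: hid.
have uI : {in U &, injective u}.
  by apply: (noncollapsing_inj (uhr one) uU cU c'U tcc'); rewrite -/(u c) uc.
have c_unique x : x \in U -> x <> c -> ~ {in U &, injective (f x)}.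
  by move=> xU xc fI; apply: xc; apply: uI => //; rewrite uc; exact: hid.
set o := u c'.
have oU : o \in U by exact: uU.
have toneo : t one o by rewrite -uc; exact: (con_up tC (uhr one)).
have ho x : x \in U -> x <> c -> d (h x o) (u x).
  by move=> xU xc; apply: hcol => //; [exact: c_unique | exact: con_sym].
(* If [h^~ o] did not collapse, it would reflect [d]; but [h c o = o = u c'] is [d]-related to
   [h c' o], which would relate [c] and [c']. *)
have ho_col : d (h a o) (h a' o).
  apply: NNPP => nd; apply: (ndcc' _).
  have hrU : {in U, forall x, h x o \in U} by move=> x xU; exact: hU.
  have hrI : {in U &, injective (h^~ o)}.
    exact: (noncollapsing_inj (uhr o) hrU aU a'U taa' nd).
  apply: (inj_reflects dC (uhr o) hrU hrI cU c'U) => /=.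
  rewrite (hid c) //; apply: con_sym => //; apply: ho => // e; apply: ndcc'.
  by rewrite e; exact: con_refl.
(* Outside the [t]-class of [c], both [a] and [a'] differ from [c], so there [u] agrees modulo [d]
   with the collapsing [h^~ o], although [u] is a permutation. *)
apply: NNPP => ntca; apply: ndaa'.
apply: (inj_reflects dC (uhr one) uU uI aU a'U); rewrite -/(u a) -/(u a').
apply: (con_trans dC (con_sym dC (ho a aU _))) => [e|].
  by apply: ntca; rewrite e; exact: con_refl.
apply: (con_trans dC ho_col (ho a' a'U _)) => e.
by apply: ntca; rewrite -e; exact: con_sym.
Qed.

(** * Several variables under the twin property *)

Definition twin : Prop := forall f c c',
  binary_poly f -> (forall x y, x \in U -> y \in U -> f x y \in U) ->
  c \in U -> c' \in U -> t c c' ->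
  {in U &, injective (f c)} -> {in U &, injective (f c')}.

Lemma twin_upd n (p : ('I_n -> A) -> A) i x z :
  twin -> poly op p -> (forall w, (forall k, w k \in U) -> p w \in U) ->
  (forall k, x k \in U) -> (forall k, z k \in U) -> (forall k, t (x k) (z k)) ->
  {in U &, injective (fun s => p (upd x i s))} ->
  {in U &, injective (fun s => p (upd z i s))}.
Proof.
move=> tw pp pU xU zU xz xI.
pose P w := (forall k, w k \in U) /\ (forall k, t (w k) (z k)) /\
  {in U &, injective (fun s => p (upd w i s))}.
suff [_ []] : P z by [].
apply: (upd_ind (P := P) (x := x)) => [w k [wU [wz wI]]|]; last by [].
have updU v j a : (forall k, v k \in U) -> a \in U -> forall k, upd v j a k \in U.
  by move=> vU aU l; rewrite /upd; case: ifP.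
split; first exact: updU.
split=> [j|].
  by rewrite {1}/upd; case: eqP => [->|_]; [exact: (con_refl tC) | exact: wz].
apply: (tw (fun a s => p (upd (upd w k a) i s)) (w k) (z k)) => //.
- exact: bp_upd.
- by move=> a s aU sU; apply/pU/updU => //; exact: updU.
- by rewrite upd_same.
Qed.

(** The passage from a quasigroup to a loop by isotopy. With [f b v = b], put [q x y] equal to [f]
    of the preimage of [x] under [f^~ v] and the preimage of [y] under [f b]. *)
Lemma twin_neutral f b : twin -> binary_poly f ->
  (forall x y, x \in U -> y \in U -> f x y \in U) ->
  b \in U -> t b (f b b) ->
  {in U &, injective (f b)} -> {in U &, injective (f^~ b)} ->
  exists q, binary_poly q /\ (forall x y, x \in U -> y \in U -> q x y \in U) /\
    (forall x, x \in U -> q b x = x /\ q x b = x).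
Proof.
move=> tw bf fU bU tbb fbI bfI.
pose m := (#|A|`!).-1; have mS : m.+1 = #|A|`! by rewrite prednK ?fact_gt0.
have fbU : {in U, forall x, f b x \in U} by move=> x; exact: fU.
pose v := iter m (f b) b.
have vU : v \in U by exact: iter_in.
have fbv : f b v = b by rewrite -iterS mS (iter_fact_card (U := U)).
have tbv : t b v.
  rewrite /v; elim: m {mS v vU fbv} => [|k IH]; first exact: (con_refl tC).
  by apply: (con_trans tC tbb); exact: (con_up tC (bp_left b bf)).
have fvU : {in U, forall x, f x v \in U} by move=> x xU; exact: fU.
have fvI : {in U &, injective (f^~ v)}.
  (* The twin property with the arguments of [f] exchanged. *)
  apply: (tw (fun x y => f y x) b v) => // [|x y xU yU]; last exact: fU.
  exact: (bp_poly bf (poly_proj op ord_max) (poly_proj op ord0)).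
have invL x : x \in U -> f b (iter m (f b) x) = x.
  by move=> xU; rewrite -iterS mS (iter_fact_card (U := U)).
have invR x : x \in U -> f (iter m (f^~ v) x) v = x.
  by move=> xU; rewrite -[LHS](iterS m (f^~ v)) mS (iter_fact_card (U := U)).
exists (fun x y => f (iter m (f^~ v) x) (iter m (f b) y)); split; [|split].
- apply: (bp_poly bf).
    exact: (up_poly (up_iter m (bp_right v bf)) (poly_proj op ord0)).
  exact: (up_poly (up_iter m (bp_left b bf)) (poly_proj op ord_max)).
- by move=> x y xU yU; apply: fU; exact: iter_in.
- move=> x xU; split; last exact: invR.
  suff -> : iter m (f^~ v) b = b by exact: invL.
  by apply: fvI => //; [exact: iter_in | rewrite /= invR].
Qed.

(* A binary polynomial with neutral element b plays the role of the Maltsev operation (x, b, z) |-> x - b + z. *)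
Lemma neutral_permute g q a b c : con g -> binary_poly q ->
  (forall x y, x \in U -> y \in U -> q x y \in U) ->
  (forall x, x \in U -> q b x = x /\ q x b = x) ->
  a \in U -> c \in U -> d a b -> g b c -> exists z, z \in U /\ g a z /\ d z c.
Proof.
move=> gC bq qU qb aU cU dab gbc; exists (q a c); split; first exact: qU.
split; first by rewrite -{1}(proj2 (qb a aU)); exact: (con_up gC (bp_left a bq)).
by rewrite -{2}(proj1 (qb c cU)); exact: (con_up dC (bp_right c bq)).
Qed.

End MinimalSet.

(** * Polynomial isomorphisms between minimal sets, and transfer of polynomials *)

Lemma minimal_sets_iso V W b b' y z :
  minimal_set op d t V -> minimal_set op d t W ->
  b \in V -> b' \in V -> t b b' -> ~ d b b' ->
  y \in W -> z \in W -> t y z -> ~ d y z ->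
  exists F G, up F /\ up G /\ (forall x, F x \in V) /\ {in V, forall x, G x \in W} /\
    {in W, cancel F G} /\ {in V, cancel G F} /\ t b (F y).
Proof.
move=> Vmin Wmin bV b'V tb ndb yW zW ty ndy.
have [eV [ueV [eVV eVid]]] := minimal_retraction Vmin.
have [eW [ueW [eWW eWid]]] := minimal_retraction Wmin.
(* The relation is [d] on [eV]-images inside the [t]-class of [b] and lumps together everything
   outside it. Separating [y] from [z] forces their images into that class. *)
have [f [uf nf]] : exists f, up f /\
    ~ ((t b (eV (f y)) <-> t b (eV (f z))) /\ (t b (eV (f y)) -> d (eV (f y)) (eV (f z)))).
  apply: (separating_poly (R := fun u v => (t b (eV u) <-> t b (eV v)) /\
    (t b (eV u) -> d (eV u) (eV v))) (x0 := b) (y0 := b')) => //.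
  - by move=> u; split=> // _; exact: (con_refl dC).
  - by move=> u v [uv duv]; split; [tauto | move=> /uv/duv; exact: (con_sym dC)].
  - move=> u v w [uv duv] [vw dvw]; split; first tauto.
    by move=> bu; apply: (con_trans dC (duv bu)); apply/dvw/uv.
  - move=> u v duv; have deuv := con_up dC ueV duv; split=> //.
    by split=> bu; apply: (con_trans tC bu); apply: d_le_t => //; exact: (con_sym dC).
  - rewrite !eVid // => -[_ db]; apply: ndb; apply: db; exact: (con_refl tC).
pose F x := eV (f x); have uF : up F by exact: (up_comp ueV uf).
have FV x : F x \in V by exact: eVV.
have [tbF ndF] : t b (F y) /\ ~ d (F y) (F z).
  have tF : t (F y) (F z) by exact: (con_up tC uF).
  apply: NNPP => no; apply: nf; split.
    by split=> bu; apply: (con_trans tC bu) => //; exact: (con_sym tC).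
  by move=> bF; apply: NNPP => nd; apply: no.
have [g [ug ng]] : exists g, up g /\ ~ d (eW (g b)) (eW (g b')).
  apply: (separating_poly (R := fun u v => d (eW u) (eW v)) (x0 := y) (y0 := z)) => //.
  - by move=> u; exact: (con_refl dC).
  - by move=> u v; exact: (con_sym dC).
  - by move=> u v w uv vw; exact: (con_trans dC uv vw).
  - by move=> u v; exact: (con_up dC ueW).
  - by rewrite !eWid.
pose H x := eW (g x); have uH : up H by exact: (up_comp ueW ug).
have HW x : H x \in W by exact: eWW.
have FWV : V \subset F @: W.
  have <- : (F \o eW) @: [set: A] = V.
    apply: (noncollapsing_onto Vmin) => [|x|]; [exact: up_comp | exact: FV |].
    by exists y, z; rewrite /= !eWid.
  by apply/subsetP=> _ /imsetP[x _ ->]; exact: imset_f.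
have HVW : W \subset H @: V.
  have <- : (H \o eV) @: [set: A] = W.
    apply: (noncollapsing_onto Wmin) => [|x|]; [exact: up_comp | exact: HW |].
    by exists b, b'; rewrite /= !eVid.
  by apply/subsetP=> _ /imsetP[x _ ->]; exact: imset_f.
have VleW := leq_trans (subset_leq_card FWV) (leq_imset_card F W).
have WleV := leq_trans (subset_leq_card HVW) (leq_imset_card H V).
have FI : {in W &, injective F}.
  apply/imset_injP; rewrite eqn_leq leq_imset_card.
  exact: leq_trans WleV (subset_leq_card FWV).
have HI : {in V &, injective H}.
  apply/imset_injP; rewrite eqn_leq leq_imset_card.
  exact: leq_trans VleW (subset_leq_card HVW).
pose m := (#|A|`!).-1; have mS : m.+1 = #|A|`! by rewrite prednK ?fact_gt0.
have HFW : {in W, forall x, (H \o F) x \in W} by move=> x _; exact: HW.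
have HFI : {in W &, injective (H \o F)}.
  by move=> u v uW vW /= e; apply: FI => //; exact: HI e.
(* Since [m.+1] is the factorial of [#|A|], the map [G \o F] is a full power of the permutation
   [H \o F] of [W]. *)
pose G x := iter m (H \o F) (H x).
have FG : {in W, cancel F G}.
  by move=> x xW; rewrite /G -[H (F x)]/((H \o F) x) -iterSr mS (iter_fact_card (U := W)).
exists F, G; split=> //; split; first exact: (up_comp (up_iter m (up_comp uH uF)) uH).
split=> //; split; first by move=> x _; apply: iter_in.
split=> //; split=> // x xV.
by have /imsetP[w wW ->] := subsetP FWV x xV; rewrite FG.
Qed.

(** Transported to [V], [p] permutes [V] in each of two influential coordinates. Freezing the others
    at [b] leaves a binary polynomial for [twin_neutral]. *)
Lemma neutral_of_nonunary V W N n (p : ('I_n -> A) -> A) b b' :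
  minimal_set op d t V -> twin V -> minimal_set op d t W -> trace d t W N ->
  poly op p -> (forall x : 'I_n -> A, (forall k, x k \in N) -> exists y, y \in N /\ d (p x) y) ->
  ~ ess_unary_mod d N p ->
  b \in V -> b' \in V -> t b b' -> ~ d b b' ->
  exists q, binary_poly q /\ (forall x y, x \in V -> y \in V -> q x y \in V) /\
    (forall x, x \in V -> q b x = x /\ q x b = x).
Proof.
move=> Vmin tw Wmin [[x0 [x0W Nx0]] [y [z [yN [zN ndyz]]]]] pp pN nunary bV b'V tb ndb.
have [yW x0y] := proj1 (Nx0 y) yN; have [zW x0z] := proj1 (Nx0 z) zN.
have NW x : x \in N -> x \in W by case/Nx0.
have Nt u v : u \in N -> v \in N -> t u v.
  by move=> /Nx0[_ xu] /Nx0[_ xv]; exact: (con_trans tC (con_sym tC xu) xv).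
have [F [G [uF [uG [FV [GW [FK [GK tbF]]]]]]]] :=
  minimal_sets_iso Vmin Wmin bV b'V tb ndb yW zW (Nt _ _ yN zN) ndyz.
have [e [ue [eW eid]]] := minimal_retraction Wmin.
have FN u : u \in N -> t b (F u).
  by move=> uN; apply: (con_trans tC tbF); apply: (con_up tC uF); exact: Nt.
have GN u : u \in V -> t b u -> G u \in N.
  move=> uV tu; apply/Nx0; split; first exact: GW.
  apply: (con_trans tC x0y); rewrite -(FK _ yW); apply: (con_up tC uG).
  exact: (con_trans tC (con_sym tC tbF) tu).
pose P x := F (e (p (fun k => G (x k)))).
have pP : poly op P.
  apply: (up_poly uF); apply: (up_poly ue); apply: (poly_comp (g := fun k x => G (x k)) pp) => k.
  exact: (up_poly uG (poly_proj op k)).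
have PV w : P w \in V by exact: FV.
(* Values of [p] lie in [N] only modulo [d]; the retraction [e] brings them into [W] without leaving
   their [d]-class. *)
have ep x : (forall k, x k \in N) -> d (p x) (e (p x)) /\ t b (F (e (p x))).
  move=> xN; have [u [uN pu]] := pN x xN.
  have epu : d (e (p x)) u by rewrite -(eid u (NW _ uN)); exact: (con_up dC ue).
  split; first exact: (con_trans dC pu (con_sym dC epu)).
  apply: (con_trans tC (FN _ uN)); apply: (con_up tC uF); apply: d_le_t.
  exact: (con_sym dC).
have dep_inj i : (exists (x : 'I_n -> A) a,
      (forall k, x k \in N) /\ a \in N /\ ~ d (p x) (p (upd x i a))) ->
    {in V &, injective (fun s => P (upd (fun=> b) i s))}.
  move=> [x [a [xN [aN nd]]]].
  have updN k : upd x i a k \in N by rewrite /upd; case: ifP.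
  have PF w : (forall k, w k \in N) -> P (fun k => F (w k)) = F (e (p w)).
    move=> wN; rewrite /P; congr (F (e (p _))); apply: functional_extensionality => k.
    by rewrite FK // NW.
  have Fupd s : upd (fun k => F (x k)) i (F s) = (fun k => F (upd x i s k)).
    by apply: functional_extensionality => k; rewrite /upd; case: ifP.
  (* The permutation is found with parameters [F (x k)]; the twin property moves them to [b]. *)
  apply: (twin_upd (x := fun k => F (x k)) tw pP) => [//|k|//|k|]; first exact: FV.
    exact/(con_sym tC)/FN.
  have uPi := up_upd (fun k => F (x k)) i pP.
  apply: (noncollapsing_inj Vmin uPi (x := F (x i)) (y := F a)) => [w _|||| dP] //.
    by apply: (con_up tC uF); exact: Nt.
  apply: nd; have [dp _] := ep x xN; have [dp' _] := ep _ updN.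
  apply: (con_trans dC dp); apply: (con_trans dC _ (con_sym dC dp')).
  rewrite -(FK (e (p x))) // -(FK (e (p (upd x i a)))) //.
  by apply: (con_up dC uG); move: dP; rewrite !Fupd !PF // upd_same.
have [i [j [ij [di dj]]]] := ess_unary_or_two_dependencies dC pp nunary.
pose f a c := P (upd (upd (fun=> b) i a) j c).
have updb k : upd (fun=> b) k b = (fun=> b) :> ('I_n -> A) by exact: (upd_same (fun=> b)).
apply: (twin_neutral tw (f := f)) => //.
- exact: bp_upd.
- by move=> u w _ _; exact: PV.
- rewrite /f !updb; apply: (proj2 (ep _ _)) => k.
  by apply: GN => //; exact: (con_refl tC).
- by rewrite /f updb; exact: dep_inj.
- move=> u w uV wV; rewrite /f /= ![upd (upd _ i _) j _]updC // updb.
  exact: (dep_inj i di).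
Qed.

End Cover.
End Algebra.

(** * The contradiction for a minimal set without tail *)

Theorem theorem2p1 (A : finType) (I : Type) (ar : I -> nat)
    (op : forall i : I, ('I_(ar i) -> A) -> A)
    (gamma delta theta : A -> A -> Prop) :
  pentagon op gamma delta theta ->
  covers op delta theta ->
  ~ typ_is_1 op delta theta ->
  forall U : {set A}, minimal_set op delta theta U ->
  nonempty_tail delta theta U.
Proof.
move=> [gC [dC [tC [[dt _] [tj gtd]]]]] cov ntyp U Umin.
apply: NNPP => notail.
have body b : b \in U -> exists b', b' \in U /\ theta b b' /\ ~ delta b b'.
  move=> bU; apply: NNPP => no_b'; apply: notail; exists b; split=> // -[N [tr bN]].
  have [[x [_ Nx]] [y [z [yN [zN nd]]]]] := tr.
  have Nb u : u \in N -> delta b u.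
    move=> /Nx[uU xu]; apply: NNPP => nbu; apply: no_b'; exists u; split=> //; split=> //.
    by have /Nx[_ xb] := bN; exact: (con_trans tC (con_sym tC xb) xu).
  by apply: nd; exact: (con_trans dC (con_sym dC (Nb y yN)) (Nb z zN)).
have [e [ue [eU eid]]] := minimal_retraction Umin.
have [_ [[x [y [xU [yU [txy ndxy]]]]] _]] := Umin.
case: (classic (twin op theta U)) => [tw|ntw]; last first.
  have [c tc] : exists c, forall a, a \in U -> theta c a.
    apply: NNPP => no_c; apply: ntw => f c c' bf fU cU c'U tcc' fcI.
    apply: NNPP => fc'I; apply: no_c; exists c => a aU.
    have [a' [a'U [taa' ndaa']]] := body a aU.
    exact: (twin_single_trace cov Umin bf fU cU c'U tcc' fcI fc'I aU a'U taa' ndaa').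
  apply: ndxy; rewrite -(eid x xU) -(eid y yU).
  apply: (le_join_retract (R := delta) tj ue gC dC) => //.
  - exact: (con_refl dC).
  - exact: (con_sym dC).
  - by move=> u v w uv vw; exact: (con_trans dC uv vw).
  - move=> u v guv; apply: gtd => //.
    exact: (con_trans tC (con_sym tC (tc _ (eU u))) (tc _ (eU v))).
have permute a b c : a \in U -> b \in U -> c \in U -> delta a b -> gamma b c ->
    exists z, z \in U /\ gamma a z /\ delta z c.
  (* The type hypothesis supplies a non-unary polynomial on a trace of some minimal set [W],
     possibly different from [U]. *)
  move=> aU bU cU dab gbc; apply: NNPP => no_z; apply: ntyp => W N Wmin tr n p pp pN.
  apply: NNPP => nunary; apply: no_z.
  have [b' [b'U [tb ndb]]] := body b bU.
  have [q [bq [qU qb]]] :=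
    neutral_of_nonunary cov Umin tw Wmin tr pp pN nunary bU b'U tb ndb.
  exact: (neutral_permute cov gC bq qU qb aU cU dab gbc).
(* [gamma] followed by [delta] on [U], with equality added for reflexivity on [A]; [permute] gives
   symmetry and transitivity. *)
pose R u v := u = v \/ (u \in U /\ v \in U /\ exists z, z \in U /\ gamma u z /\ delta z v).
have [z [zU [gxz dzy]]] : exists z, z \in U /\ gamma x z /\ delta z y.
  suff: R x y.
    case=> [xy|[_ [_ //]]]; exists x; rewrite -xy.
    by do 2?split=> //; [exact: (con_refl gC) | exact: (con_refl dC)].
  rewrite -(eid x xU) -(eid y yU).
  apply: (le_join_retract (R := R) tj ue gC dC) => //.
  - by move=> u; left.
  - move=> u v [->|[uU [vU [z [zU [guz dzv]]]]]]; first by left.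
    right; do 2!split=> //.
    by apply: (permute v z u) => //; [exact: (con_sym dC) | exact: (con_sym gC)].
  - move=> u v w [->//|[uU [vU [z [zU [guz dzv]]]]]] [<-|[_ [wU [z' [z'U [gvz' dz'w]]]]]].
      by right; do 2!split=> //; exists z.
    right; do 2!split=> //.
    have [z'' [z''U [gzz'' dz''z']]] := permute z v z' zU vU z'U dzv gvz'.
    exists z''; split=> //; split; first exact: (con_trans gC guz gzz'').
    exact: (con_trans dC dz''z' dz'w).
  - by move=> u v guv; right; do 2!split=> //; exists (e v); do 2!split=> //; exact: (con_refl dC).
  - by move=> u v duv; right; do 2!split=> //; exists (e u); do 2!split=> //; exact: (con_refl gC).
(* The modular law: [z] is [theta]-related to [x], so [gamma x z] gives [delta x z]. *)
apply: ndxy; apply: (con_trans dC _ dzy); apply: gtd => //.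
exact: (con_trans tC txy (con_sym tC (dt _ _ dzy))).
Qed.
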